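(* Let $X,Y,Z$ be quasi-normed spaces, let $\tau:X\times Y\to Z$ be a bounded bilinear operator, and let $n\ge1$. Then there is a constant $C$, depending only on $n$ and the quasi-triangle constants of $X,Y,Z$, such that for all $\vec x=(x_1,\dots,x_n)\in X\otimes\mathbb R^n\cong X^n$ and $\vec y=(y_1,\dots,y_n)\in Y\otimes\mathbb R^n\cong Y^n$, with $\tau(\vec x,\vec y):=\sum_{i=1}^n\tau(x_i,y_i)$, we have $$\|\tau(\vec x,\vec y)\|_Z\le C\,\|\tau\|\,\big|[\vec x]_X[\vec y]_Y\big|.$$
   Context: All vector spaces are real. A quasi-norm satisfies the axioms of a norm except that the triangle inequality is relaxed to $\|x+y\|\le K(\|x\|+\|y\|)$ for a constant $K\ge1$ (the quasi-triangle constant); a quasi-normed space is a vector space with a quasi-norm, not necessarily complete. $\|\tau\|$ is the least constant $M$ with $\|\tau(x,y)\|_Z\le M\|x\|_X\|y\|_Y$ for all $x\in X$, $y\in Y$; $\tau$ is bounded if $\|\tau\|<\infty$. Reducing matrices: for a quasi-normed space $X$ with quasi-triangle constant $K$, $\vec x=(x_1,\dots,x_n)\in X^n\cong X\otimes\mathbb R^n$ and $\vec e\in\mathbb R^n$, put $\vec x\cdot\vec e:=\sum_{i=1}^n e_ix_i\in X$. Then $\vec e\mapsto\|\vec x\cdot\vec e\|_X$ is a semi-quasi-norm on $\mathbb R^n$, and $[\vec x]_X$ denotes any positive semi-definite $n\times n$ matrix with $$c^{-1}\,|[\vec x]_X\vec e|\le\|\vec x\cdot\vec e\|_X\le c\,|[\vec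 x]_X\vec e|\qquad\forall\vec e\in\mathbb R^n,$$ where $c=c(n,K)\ge1$ is a fixed constant depending only on $n$ and $K$, for which such a matrix always exists. The matrix is not unique; the statement holds for any choice. $|\cdot|$ is the Euclidean norm of vectors and the corresponding operator norm of matrices. *)

(* Defs.v *)
From HB Require Import structures.
From mathcomp Require Import all_boot all_order all_algebra.
From mathcomp Require Import boolp classical_sets reals.

Set Implicit Arguments.
Unset Strict Implicit.
Unset Printing Implicit Defensive.

Import Order.TTheory GRing.Theory Num.Theory.
Local Open Scope classical_set_scope.
Local Open Scope ring_scope.

Record quasinorm (R : realType) (X : lmodType R) (K : R) (N : X -> R) : Prop :=
  Quasinorm {
    quasinorm_const_ge1 : 1 <= K ;
    quasinorm_ge0 : forall x, 0 <= N x ;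
    quasinorm_eq0 : forall x, N x = 0 <-> x = 0 ;
    quasinormZ : forall (a : R) x, N (a *: x) = `|a| * N x ;
    quasinorm_triangle : forall x y, N (x + y) <= K * (N x + N y)
  }.

(* The requirement 0 <= M only matters when X or Y is trivial, where every
   real number would otherwise be a bound. *)
Definition bilin_bounds (R : realType) (X Y Z : lmodType R)
    (NX : X -> R) (NY : Y -> R) (NZ : Z -> R) (tau : X -> Y -> Z) : set R :=
  [set M | 0 <= M /\ forall x y, NZ (tau x y) <= M * NX x * NY y].

Definition bounded_bilin (R : realType) (X Y Z : lmodType R)
    (NX : X -> R) (NY : Y -> R) (NZ : Z -> R) (tau : X -> Y -> Z) : Prop :=
  bilin_bounds NX NY NZ tau !=set0.

(* If tau is bounded, bilin_bounds is a nonempty closed subset of [0, +oo[,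
   so this infimum is its least element. *)
Definition bilin_norm (R : realType) (X Y Z : lmodType R)
    (NX : X -> R) (NY : Y -> R) (NZ : Z -> R) (tau : X -> Y -> Z) : R :=
  inf (bilin_bounds NX NY NZ tau).

(* The library's norm on matrices is the max-norm, whence the next two
   definitions. *)
Definition euclid_norm (R : realType) (n : nat) (v : 'cV[R]_n) : R :=
  Num.sqrt (\sum_(i < n) v i 0 ^+ 2).

Definition mx_opnorm (R : realType) (n : nat) (A : 'M[R]_n) : R :=
  sup [set euclid_norm (A *m e) | e in [set e | euclid_norm e <= 1]].

Definition psd_mx (R : realType) (n : nat) (A : 'M[R]_n) : Prop :=
  A^T = A /\ forall e : 'cV[R]_n, 0 <= (e^T *m A *m e) 0 0.

Definition vdot (R : realType) (X : lmodType R) (n : nat)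
    (x : 'I_n -> X) (e : 'cV[R]_n) : X :=
  \sum_(i < n) e i 0 *: x i.

(* A is an admissible choice of the reducing matrix [x]_X, with constant c. *)
Definition reducing_mx (R : realType) (X : lmodType R) (N : X -> R) (c : R)
    (n : nat) (x : 'I_n -> X) (A : 'M[R]_n) : Prop :=
  psd_mx A /\
  forall e : 'cV[R]_n,
    c^-1 * euclid_norm (A *m e) <= N (vdot x e) <= c * euclid_norm (A *m e).

(* c n K is the constant fixed once and for all in the notion of reducing
   matrix: with it, reducing matrices exist in every quasi-normed space with
   quasi-triangle constant K. *)
Definition reducing_constant (R : realType) (c : nat -> R -> R) : Prop :=
  forall (n : nat) (K : R), 1 <= K ->
    1 <= c n K /\
    forall (X : lmodType R) (N : X -> R), quasinorm K N ->
    forall x : 'I_n -> X, exists A : 'M[R]_n, reducing_mx N (c n K) x A.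

(* Main.v *)
(* Let e_1, ..., e_n be the standard basis.  If A = [x]_X is invertible, then
   inserting A^{-1} A = 1 rewrites sum_i tau(x_i, y_i) as
   sum_k tau(x . A^{-1} e_k, y . A e_k).  Here |A (A^{-1} e_k)| = 1, while
   |B A e_k| is the length of the k-th row of A B, which |A B| controls.  When
   A is singular, A^{-1} is replaced by a least-squares inverse G: A G is then
   an orthogonal projection, so |A G e_k| <= 1, and A G A = A still suffices
   since x . e depends on e only through A e. *)
Require Import Defs.
From HB Require Import structures.
From mathcomp Require Import all_boot all_order all_algebra.
From mathcomp Require Import boolp classical_sets reals.
Import Order.TTheory GRing.Theory Num.Theory.
Local Open Scope ring_scope.

(** The diagonal entries of [A *m A^T] are the sums of squares of the rows of [A]. *)
Lemma mulmx_tr_eq0 {R : realDomainType} {m n : nat} (A : 'M[R]_(m, n)) :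
  A *m A^T = 0 -> A = 0.
Proof.
move=> AAT0; apply/matrixP => i j; rewrite mxE.
have: (A *m A^T) i i = 0 by rewrite AAT0 mxE.
rewrite mxE => /psumr_eq0P h.
have /eqP : A i j * A^T j i = 0.
  by apply: h => // k _; rewrite mxE -expr2 sqr_ge0.
by rewrite mxE mulf_eq0 orbb => /eqP.
Qed.

(** [A^T *m A] has the same rank as [A], hence the same row space; transposing [A = D *m (A^T *m A)]
    gives the witness [D^T]. *)
Lemma normal_equation {R : realFieldType} {m n : nat} (A : 'M[R]_(m, n)) :
  exists G : 'M[R]_(n, m), A^T *m A *m G = A^T.
Proof.
suff /submxP[D AD] : (A <= A^T *m A)%MS.
  by exists D^T; rewrite {3}AD !trmx_mul trmxK.
rewrite -(mxrank_leqif_sup (submxMl A^T A)).2 -(mxrank_tr A).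
rewrite -(mxrank_mul_ker A^T A).
suff -> : (A^T :&: kermx A)%MS = 0 by rewrite mxrank0 addn0 eqxx.
(* If [u = w *m A^T] and [w *m A^T *m A = 0], then [u *m u^T = 0]. *)
apply/eqP/rowV0P => u; rewrite sub_capmx => /andP[/submxP[w ->]].
move=> /sub_kermxP wAA0; apply: mulmx_tr_eq0.
by rewrite trmx_mul trmxK mulmxA wAA0 mul0mx.
Qed.

(** By the normal equation, [P = A *m G] satisfies [P^T *m P = P^T], so [P] is symmetric and
    idempotent. Its column [i] has squared length [P i i], and [P i i ^+ 2 <= P i i] forces
    [P i i <= 1]. *)
Lemma least_squares_inverse {R : realFieldType} {m n : nat} (A : 'M[R]_(m, n)) :
  exists G : 'M[R]_(n, m),
    A *m G *m A = A /\ forall i, \sum_j (A *m G) j i ^+ 2 <= 1.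
Proof.
have [G AAG] := normal_equation A; exists G.
have PTP : (A *m G)^T *m (A *m G) = (A *m G)^T.
  by rewrite trmx_mul -mulmxA (mulmxA A^T) AAG.
have PT : (A *m G)^T = A *m G.
  move: (A *m G) PTP => P PTP; apply: trmx_inj.
  by rewrite -{1}PTP trmx_mul trmxK.
split; first by apply: trmx_inj; rewrite trmx_mul PT mulmxA.
move=> i; have Pii : \sum_j (A *m G) j i ^+ 2 = (A *m G) i i.
  rewrite -[in RHS]PT -PTP mxE.
  by apply: eq_bigr => j _; rewrite [X in X * _]mxE expr2.
have : (A *m G) i i ^+ 2 <= (A *m G) i i.
  rewrite -[leRHS]Pii (bigD1 i) //= lerDl.
  by apply: sumr_ge0 => j _; apply: sqr_ge0.
rewrite Pii => P2P; rewrite leNgt; apply/negP => P_gt1.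
by move: P2P; rewrite expr2 ger_pMl ?(lt_trans ltr01) // leNgt P_gt1.
Qed.

Section EuclideanNorm.
Context {R : realType} {n : nat}.
Implicit Types (v : 'cV[R]_n) (M : 'M[R]_n).

Lemma euclid_norm0 : euclid_norm (0 : 'cV[R]_n) = 0.
Proof.
by rewrite /euclid_norm big1 ?sqrtr0 // => i _; rewrite mxE expr0n.
Qed.

Lemma ler_entry_euclid_norm v i : `|v i 0| <= euclid_norm v.
Proof.
rewrite -sqrtr_sqr ler_wsqrtr // (bigD1 i) //= lerDl.
by apply: sumr_ge0 => j _; apply: sqr_ge0.
Qed.

Lemma euclid_norm_le v b :
  (forall i, `|v i 0| <= b) -> euclid_norm v <= n%:R * b.
Proof.
(* For [n = 0] the sign of [b] is unknown, but both sides vanish. *)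
case: n v => [|m] v vb; first by rewrite /euclid_norm big_ord0 sqrtr0 mul0r.
have b0 : 0 <= b by apply: le_trans (vb ord0).
rewrite -[leRHS]ger0_norm ?mulr_ge0 // -sqrtr_sqr ler_wsqrtr //.
apply: (@le_trans _ _ (\sum_(i < m.+1) b ^+ 2)).
  apply: ler_sum => i _; rewrite -real_normK ?num_real //.
  by rewrite ler_sqr ?nnegrE.
rewrite sumr_const card_ord exprMn -[leLHS]mulr_natl ler_wpM2r ?sqr_ge0 //.
by rewrite -natrX ler_nat leq_pmulr.
Qed.

Lemma euclid_norm_mulmx_le_opnorm M v :
  euclid_norm v <= 1 -> euclid_norm (M *m v) <= mx_opnorm M.
Proof.
move=> v1; apply: ub_le_sup; last by exists v.
(* A supremum dominates its set only if the set is bounded above; a crude bound by the entries of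
   [M] is enough. *)
exists (n%:R * \sum_i \sum_j `|M i j|) => _ [e e1 <-].
apply: euclid_norm_le => i; rewrite mxE.
apply: le_trans (ler_norm_sum _ _ _) _.
rewrite [leRHS](bigD1 i) //=; apply: (@le_trans _ _ (\sum_j `|M i j|)).
  apply: ler_sum => j _; rewrite normrM ler_piMr //.
  exact: le_trans (ler_entry_euclid_norm _ _) e1.
by rewrite lerDl; apply: sumr_ge0 => k _; apply: sumr_ge0.
Qed.

Lemma ler_entry_opnorm M i j : `|M i j| <= mx_opnorm M.
Proof.
have -> : M i j = (M *m delta_mx j 0 : 'cV_n) i 0 by rewrite -colE mxE.
apply: le_trans (ler_entry_euclid_norm _ _) _.
apply: euclid_norm_mulmx_le_opnorm.
rewrite /euclid_norm (bigD1 j) //= big1 => [|k kj].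
  by rewrite mxE !eqxx expr1n addr0 sqrtr1.
by rewrite mxE (negPf kj) expr0n.
Qed.

End EuclideanNorm.

(** Each further summand costs one factor [K]; the last term needs only one, and [1 <= K ^+ m]
    absorbs the rest. *)
Lemma quasinorm_sum {R : realType} {X : lmodType R} {K : R} {N : X -> R}
    (qN : quasinorm K N) (m : nat) (z : 'I_m -> X) :
  N (\sum_(i < m) z i) <= K ^+ m * \sum_(i < m) N (z i).
Proof.
have K1 := quasinorm_const_ge1 qN; have N0 := quasinorm_ge0 qN.
have K0 : 0 <= K := le_trans ler01 K1.
elim: m z => [|m IH] z.
  by rewrite !big_ord0 mulr0 (quasinorm_eq0 qN 0).2.
rewrite !big_ord_recr /=; apply: le_trans (quasinorm_triangle qN _ _) _.
rewrite exprS -mulrA ler_wpM2l // mulrDr lerD ?IH //.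
by rewrite ler_peMl // exprn_ege1.
Qed.

Lemma bilin_norm_ge0 {R : realType} {X Y Z : lmodType R}
    {NX : X -> R} {NY : Y -> R} {NZ : Z -> R} {tau : X -> Y -> Z} :
  bounded_bilin NX NY NZ tau -> 0 <= bilin_norm NX NY NZ tau.
Proof. by move=> tau_bnd; apply: lb_le_inf => // M []. Qed.

Lemma bilin_normP {R : realType} {X Y Z : lmodType R}
    {NX : X -> R} {NY : Y -> R} {NZ : Z -> R} {tau : X -> Y -> Z} :
  (forall x, 0 <= NX x) -> (forall y, 0 <= NY y) ->
  bounded_bilin NX NY NZ tau ->
  forall x y, NZ (tau x y) <= bilin_norm NX NY NZ tau * NX x * NY y.
Proof.
move=> NX0 NY0 tau_bnd x y; rewrite -mulrA.
(* If the product of the norms is zero, any bound [M] gives the claim; otherwise dividing by it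
   yields a lower bound of all [M]. *)
have := mulr_ge0 (NX0 x) (NY0 y); rewrite le_eqVlt => /predU1P[p0|p0].
  by have [M [_ /(_ x y)]] := tau_bnd; rewrite -mulrA -p0 !mulr0.
rewrite -ler_pdivrMr //; apply: lb_le_inf => // M [_ /(_ x y)].
by rewrite ler_pdivrMr // mulrA.
Qed.

(** The upper reducing bound at [e - f] is zero, and [N] is definite. *)
Lemma vdot_eq {R : realType} {X : lmodType R} {K : R} {N : X -> R}
    (qN : quasinorm K N) {c : R} {n : nat} {x : 'I_n -> X} {A : 'M[R]_n} :
  reducing_mx N c x A ->
  forall e f : 'cV[R]_n, A *m e = A *m f -> vdot x e = vdot x f.
Proof.
move=> [_ xA] e f Aef.
suff : vdot x (e - f) = 0.
  move=> /eqP; rewrite /vdot.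
  under eq_bigr do rewrite 2!mxE scalerBl.
  by rewrite sumrB subr_eq0 => /eqP.
apply/(quasinorm_eq0 qN)/eqP; rewrite eq_le (quasinorm_ge0 qN) andbT.
by have /andP[_] := xA (e - f); rewrite mulmxBr Aef subrr euclid_norm0 mulr0.
Qed.

Lemma vdot_mulmx {R : realType} {X : lmodType R} {m n : nat} (x : 'I_n -> X)
    (G : 'M[R]_(n, m)) (e : 'cV[R]_m) :
  vdot x (G *m e) = \sum_k e k 0 *: vdot x (col k G).
Proof.
rewrite /vdot; under [RHS]eq_bigr do rewrite scaler_sumr.
rewrite exchange_big; apply: eq_bigr => i _ /=.
rewrite mxE scaler_suml; apply: eq_bigr => k _.
by rewrite mxE scalerA mulrC.
Qed.

Lemma vdot_delta {R : realType} {X : lmodType R} {n : nat} (x : 'I_n -> X) i :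
  vdot x (delta_mx i 0 : 'cV[R]_n) = x i.
Proof.
rewrite /vdot (bigD1 i) //= big1 => [|j ji].
  by rewrite mxE !eqxx scale1r addr0.
by rewrite mxE (negPf ji) scale0r.
Qed.

(** Since [A *m G *m A = A], the vector [x i] equals [vdot x] at [G *m A *m delta_mx i 0]. Expanding
    along the columns of [G] leaves coefficients [A i k], by symmetry of [A], and bilinearity moves
    them onto [y]. *)
Lemma sum_bilin_reducing {R : realType} {X Y Z : lmodType R} {K : R}
    {NX : X -> R} (qX : quasinorm K NX) (tau : {bilinear X -> Y -> Z})
    {c : R} {n : nat} {x : 'I_n -> X} (y : 'I_n -> Y) {A G : 'M[R]_n} :
  reducing_mx NX c x A -> A *m G *m A = A ->
  \sum_i tau (x i) (y i) = \sum_k tau (vdot x (col k G)) (vdot y (col k A)).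
Proof.
move=> xA AGA; have [[AT _] _] := xA.
have xE i : x i = \sum_k A i k *: vdot x (col k G).
  rewrite -[LHS]vdot_delta (vdot_eq qX xA _ (G *m (A *m delta_mx i 0))).
    by rewrite vdot_mulmx; apply: eq_bigr => k _; rewrite -colE -{2}AT !mxE.
  by rewrite !mulmxA AGA.
under eq_bigr do rewrite xE linear_sumlz.
rewrite exchange_big; apply: eq_bigr => k _ /=.
rewrite /vdot linear_sumr; apply: eq_bigr => i _.
by rewrite linearZl_LR linearZr_LR mxE.
Qed.

Theorem proposition4p1 (R : realType) (c : nat -> R -> R)
    (hc : reducing_constant c)
    (n : nat) (hn : (1 <= n)%N)
    (KX KY KZ : R) :
  exists C : R,
    forall (X Y Z : lmodType R) (NX : X -> R) (NY : Y -> R) (NZ : Z -> R),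
      quasinorm KX NX -> quasinorm KY NY -> quasinorm KZ NZ ->
    forall tau : {bilinear X -> Y -> Z},
      bounded_bilin NX NY NZ tau ->
    forall (x : 'I_n -> X) (y : 'I_n -> Y) (A B : 'M[R]_n),
      reducing_mx NX (c n KX) x A ->
      reducing_mx NY (c n KY) y B ->
      NZ (\sum_(i < n) tau (x i) (y i))
        <= C * bilin_norm NX NY NZ tau * mx_opnorm (A *m B).
Proof.
(* The factors come from the quasi-triangle inequality for [n] terms, the number of terms, the bound
   [xk], and the bound [yk]. *)
exists (KZ ^+ n * (n%:R * (c n KX * (c n KY * n%:R)))).
move=> X Y Z NX NY NZ qX qY qZ tau tau_bnd x y A B xA yB.
have cX0 : 0 <= c n KX.
  exact: le_trans ler01 (hc n KX (quasinorm_const_ge1 qX)).1.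
have cY0 : 0 <= c n KY.
  exact: le_trans ler01 (hc n KY (quasinorm_const_ge1 qY)).1.
have KZ0 : 0 <= KZ := le_trans ler01 (quasinorm_const_ge1 qZ).
have [G [AGA AG1]] := least_squares_inverse A.
rewrite (sum_bilin_reducing qX tau y xA AGA).
apply: le_trans (quasinorm_sum qZ _ _) _.
rewrite -!mulrA; apply: ler_wpM2l; first exact: exprn_ge0.
set op := mx_opnorm _; set t := bilin_norm _ _ _ _.
rewrite [leRHS]mulr_natl -[n in _ *+ n]card_ord -sumr_const.
apply: ler_sum => k _.
(* [A *m col k G] is a column of the projection [A *m G], of length at most 1. *)
have xk : NX (vdot x (col k G)) <= c n KX.
  have /andP[_ /le_trans] := xA.2 (col k G); apply.
  rewrite ler_piMr // /euclid_norm -[leRHS]sqrtr1 ler_wsqrtr //.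
  apply: le_trans (AG1 k); apply: ler_sum => j _.
  by rewrite colE mulmxA -colE mxE.
(* As [A] and [B] are symmetric, [B *m A] is the transpose of [A *m B], so its entries are at most
   [op]; passing from entries to the length of a column costs [n]. *)
have yk : NY (vdot y (col k A)) <= c n KY * (n%:R * op).
  have /andP[_ /le_trans] := yB.2 (col k A); apply.
  apply: ler_wpM2l => //; apply: euclid_norm_le => i.
  rewrite colE mulmxA -colE mxE -{1}yB.1.1 -{1}xA.1.1 -trmx_mul mxE.
  exact: ler_entry_opnorm.
have tauP := bilin_normP (quasinorm_ge0 qX) (quasinorm_ge0 qY) tau_bnd.
apply: le_trans (tauP _ _) _.
rewrite -/t; have t0 : 0 <= t := bilin_norm_ge0 tau_bnd.
have -> : c n KX * (c n KY * (n%:R * (t * op)))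
        = t * c n KX * (c n KY * (n%:R * op)).
  by rewrite (mulrCA n%:R t) (mulrCA (c n KY) t) (mulrCA _ t) mulrA.
apply: ler_pM => //; first exact: mulr_ge0 t0 (quasinorm_ge0 qX _).
  exact: quasinorm_ge0 qY _.
exact: ler_wpM2l.
Qed.
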